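(* Khovanov homology satisfies the FI relation. More precisely, suppose $L$ is a singular link one of whose double points is of the following form: $L$ has a diagram $D$ with a double point $b$ and a disc in the plane inside which $D$ consists of a single arc forming a kink (one loop) whose only self-intersection is the double point $b$. Then $\mathit{Kh}^{i,j}(L;\mathbb F_2)=0$ for all integers $i$ and $j$.
   Context: All links and diagrams are oriented. A singular link is an immersion of finitely many oriented circles in $S^3$ whose only singularities are finitely many transverse double points, considered up to ambient isotopy; a singular link diagram is a generic plane projection with ordinary (over/under) crossings and marked double points. Frobenius algebra. $A=\mathbb Z[x]/(x^2)$ with the usual multiplication $\mu$ and comultiplication $\Delta(1)=x\otimes1+1\otimes x$, $\Delta(x)=x\otimes x$; grading $\deg 1=1$, $\deg x=-1$. For a closed $1$-manifold $W$, $Z_A(W)=A^{\otimes\pi_0(W)}$; a saddle cobordism acts by $\mu$ if it merges two circles and by $\Delta$ if it splits one circle. Khovanov complex of an ordinary diagram $D$. Let $c(D)$ be the set of crossings. The $0$-smoothing of a crossing joins the two regions swept out when the overstrand is rotated counterclockwise until it meets the understrand; the $1$-smoothing is the other one (so the orientation-respecting smoothing is the $0$-smoothing at a positive crossing and the $1$-smoothing at a negative crossing). A state is a subset $s\subset c(D)$, and $D_s$ is the result of $1$-smoothing the crossings in $s$ and $0$-smoothing the others. Put $\overline C^{i,j}(D)=\bigoplus_{|s|=i}Z_A(D_s)^{j-i}$ (superscript on $Z_A$: homogeneous degree), with $d=\sum_{c}\pm\delta_c$, where $\delta_c:Z_A(D_s)\to Z_A(D_{s\cup\{c\}})$ for $c\notin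 s$ is the saddle map, $\delta_c=0$ for $c\in s$, and the signs are the standard ones making $d^2=0$ (irrelevant mod $2$). With $n_\pm$ the numbers of positive/negative crossings, $C^{i,j}(D)=\overline C^{i+n_-,\,j+2n_--n_+}(D)$ with the same differential. Genus-$1$ map. Let $D_-$ be an ordinary diagram with a negative crossing $b$ and let $D_+$ be obtained by changing $b$ to a positive crossing. The orientation-respecting smoothing at $b$ is the $1$-smoothing for $D_-$ and the $0$-smoothing for $D_+$. The genus-$1$ map $\widehat\Phi_b:C(D_-)\otimes\mathbb F_2\to C(D_+)\otimes\mathbb F_2$ is the chain map of bidegree $(0,0)$ that is zero on the summands for states $s\not\ni b$, and for $s\ni b$ sends $Z_A((D_-)_s)\otimes\mathbb F_2$ to $Z_A((D_+)_{s\setminus\{b\}})\otimes\mathbb F_2$ (the same $1$-manifold) by the composition of the saddle at $b$ followed by the reverse saddle: if the two strands at $b$ lie on different circles labelled $p,q$ this is $p\otimes q\mapsto\Delta(pq)$, and if they lie on the same circle labelled $p$ it is $p\mapsto\mu(\Delta(p))$; it is the identity on the other tensor factors. Singular diagrams. For a singular link diagram $D$ with set $c^\sharp(D)$ of double points and $S\subset c^\sharp(D)$, let $D_S$ be the ordinary diagram obtained by resolving the double points in $S$ to positive crossings and the others to negative crossings. The maps $\widehat\Phi_b:C(D_S)\otimes\mathbb F_2\to C(D_{S\cup\{b\}})\otimes\mathbb F_2$ ($b\notin S$) commute for distinct $b$. The Khovanov complex $C(D;\mathbb F_2)$ is the multiple mapping cone $$C^{i,j}(D;\mathbb F_2)=\bigoplus_{S\subset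 c^\sharp(D)}C^{\,i+|c^\sharp(D)\setminus S|,\,j}(D_S)\otimes\mathbb F_2,$$ whose differential is, on the $S$-summand, the sum of the differential of $C(D_S)\otimes\mathbb F_2$ and of all $\widehat\Phi_b$ with $b\in c^\sharp(D)\setminus S$ (signs are irrelevant in characteristic $2$). Put $\mathit{Kh}^{i,j}(D;\mathbb F_2)=H^i(C^{*,j}(D;\mathbb F_2))$; up to isomorphism it depends only on the singular link $L$ represented by $D$ and is written $\mathit{Kh}^{i,j}(L;\mathbb F_2)$. *)

(* Defs.v *)
From HB Require Import structures.
From mathcomp Require Import all_boot all_order all_fingroup all_algebra.
Set Implicit Arguments.
Unset Strict Implicit.
Unset Printing Implicit Defensive.
Import GRing.Theory.
Local Open Scope ring_scope.

(* A crossing of two oriented strands is drawn with both strands going upwards.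
   Its four corners are encoded as pairs (out, right):
     (true, false) NW      NE (true, true)
     (false, false) SW     SE (false, true)
   so that the strands run SW -> NE and SE -> NW. At a Positive vertex the
   strand SW -> NE is the overstrand, at a Negative vertex it is the
   understrand, and a Double vertex is a transverse double point. *)
Inductive vertex_kind := Positive | Negative | Double.

(* An oriented 4-valent graph with a rotation system, up to the
   placement of its connected components in the plane, which has no effect on
   the Khovanov complex. The edge leaving v at its right (r = true) or left
   (r = false) outgoing corner enters w at its right or left incoming corner,
   where (w, r') = glue (v, r). The components of the link without any vertex
   are only counted. *)
Record shadow := Shadow {
  vertex :> finType;
  glue : {perm vertex * bool};
  free_circles : nat
}.

Section Shadow.
Variable G : shadow.

Definition corner : finType := (G * (bool * bool))%type.

Definition edge (x : corner) : corner :=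
  let: (v, (out, r)) := x in
  let: (w, r') := (if out then glue G else (glue G)^-1%g) (v, r) in
  (w, (~~ out, r')).

(* The next corner of the same vertex, counterclockwise. *)
Definition rotation (x : corner) : corner :=
  let: (v, (out, r)) := x in (v, (r, ~~ out)).

(* The 4-valent graph has #|G| vertices and 2 #|G| edges; its faces, taken one
   connected component at a time, are the cycles of rotation \o edge. Each
   connected component lies on a sphere iff Euler's formula
   V - E + F = 2 * (number of components) holds. *)
Definition planar : bool :=
  (fcard (fun x => rotation (edge x)) predT + #|G|
   == 2 * #|G| + 2 * n_comp [rel x y | (y == rotation x) || (y == edge x)] predT)%N.

(* The edge from v to itself joins two adjacent corners on the right (or left)
   of v, hence bounds a face with a single side. *)
Definition is_kink (v : G) : Prop := exists r : bool, glue G (v, r) = (v, r).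

Definition point : finType := (corner + 'I_(free_circles G))%type.

(* O is the set of vertices at which the orientation-respecting smoothing
   (SW--NW, SE--NE) is made; the other vertices get SW--SE, NW--NE. *)
Definition smooth (O : {set G}) (x : corner) : corner :=
  let: (v, (out, r)) := x in
  if v \in O then (v, (~~ out, r)) else (v, (out, ~~ r)).

Definition smoothing_rel (O : {set G}) : rel point := fun x y =>
  match x, y with
  | inl a, inl b => (b == edge a) || (b == smooth O a)
  | _, _ => false
  end.

Definition circle (O : {set G}) (x : point) : {set point} :=
  [set y | connect (smoothing_rel O) x y].

Definition circles (O : {set G}) : {set {set point}} :=
  [set circle O x | x : point].

(* SW and NE never lie on the same one of the two arcs at a smoothed vertex. *)
Definition strand1 (O : {set G}) (v : G) : {set point} :=
  circle O (inl (v, (false, false))).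
Definition strand2 (O : {set G}) (v : G) : {set point} :=
  circle O (inl (v, (true, true))).

(* In A = Z[x]/(x^2), 1 is encoded by false and x by true; these are the structure
   constants of the multiplication and comultiplication. *)
Definition mu (p q r : bool) : nat := (p + q == r)%N.
Definition Delta (p q r : bool) : nat := if p then q && r else q (+) r.

(* The standard basis of Z_A (W) for W the set of circles of a smoothing is
   indexed by the sets X \subset W: the circles in X are labelled by x and the
   others by 1. The maps below are given by their matrices over F_2, X being
   the source index and Y the target index. *)

Definition label_degree (W X : {set {set point}}) : int :=
  #|W :\: X|%:Z - #|W :&: X|%:Z.

Definition saddle (v : G) (O O' : {set G}) (X Y : {set {set point}}) : 'F_2 :=
  let: (p, q) := (strand1 O v, strand2 O v) in
  let: (p', q') := (strand1 O' v, strand2 O' v) in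
  if X :\: [set p; q] != Y :\: [set p'; q'] then 0
  else if (p != q) && (p' == q') then (mu (p \in X) (q \in X) (p' \in Y))%:R
  else if (p == q) && (p' != q') then (Delta (p \in X) (p' \in Y) (q' \in Y))%:R
  else 0. (* does not happen for a planar shadow *)

Definition genus1 (v : G) (O : {set G}) (X Y : {set {set point}}) : 'F_2 :=
  let: (p, q) := (strand1 O v, strand2 O v) in
  if X :\: [set p; q] != Y :\: [set p; q] then 0
  else if p != q then
    \sum_(r : bool)
      (mu (p \in X) (q \in X) r * Delta r (p \in Y) (q \in Y))%:R
  else
    \sum_(r : bool) \sum_(r' : bool)
      (Delta (p \in X) r r' * mu r r' (p \in Y))%:R.

(* Every vertex is a crossing; P is the set of positive ones. A basis element
   is a state s with a set X of circles of the smoothing. *)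
Definition enhanced_state : finType := ({set G} * {set {set point}})%type.

Section Ordinary.
Variable P : {set G}.

(* The orientation-respecting smoothing is the 0-smoothing at a positive
   crossing and the 1-smoothing at a negative crossing. *)
Definition oriented_at (s : {set G}) : {set G} :=
  [set v | (v \in s) != (v \in P)].

Definition in_Cbar (i j : int) (e : enhanced_state) : bool :=
  let W := circles (oriented_at e.1) in
  [&& e.2 \subset W, #|e.1|%:Z == i & label_degree W e.2 == j - i].

Definition n_plus : int := #|P|%:Z.
Definition n_minus : int := #|~: P|%:Z.

Definition in_C (i j : int) (e : enhanced_state) : bool :=
  in_Cbar (i + n_minus) (j + 2 * n_minus - n_plus) e.

Definition diff (e e' : enhanced_state) : 'F_2 :=
  \sum_(c | c \notin e.1)
    (if e'.1 == c |: e.1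
     then saddle c (oriented_at e.1) (oriented_at e'.1) e.2 e'.2 else 0).

(* The genus-1 map at the negative crossing b, to the diagram whose positive
   crossings are b |: P. *)
Definition Phi (b : G) (e e' : enhanced_state) : 'F_2 :=
  if (b \in e.1) && (e'.1 == e.1 :\ b)
  then genus1 b (oriented_at e.1) e.2 e'.2 else 0.

End Ordinary.
End Shadow.

Record singular_diagram := SingularDiagram {
  underlying :> shadow;
  kind : underlying -> vertex_kind;
  diagram_planar : planar underlying
}.

(* H(U --f--> V --g--> W) = ker g / (im f \cap ker g) *)
Definition homology (K : fieldType) (U V W : vectType K)
    (f : 'Hom(U, V)) (g : 'Hom(V, W)) : zmodType :=
  {ideal_quot (linfun (@vsval K V (lker g)) @^-1: limg f)%VS}.

Section Singular.
Variable D : singular_diagram.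

Definition double_points : {set D} :=
  [set v | if kind v is Double then true else false].

(* The positive crossings of the resolution D_S. *)
Definition resolution (S : {set D}) : {set D} :=
  [set v | match kind v with
           | Positive => true | Negative => false | Double => v \in S end].

Definition cone_state : finType := ({set D} * enhanced_state D)%type.

Definition in_cone (i j : int) (t : cone_state) : bool :=
  (t.1 \subset double_points) &&
  in_C (resolution t.1) (i + #|double_points :\: t.1|%:Z) j t.2.

Definition cone_diff (t t' : cone_state) : 'F_2 :=
  (if t'.1 == t.1 then diff (resolution t.1) t.2 t'.2 else 0) +
  \sum_(b in double_points :\: t.1)
    (if t'.1 == b |: t.1 then Phi (resolution t.1) b t.2 t'.2 else 0).

(* The F_2-vector space with basis the cone states of bidegree (i, j). *)
Definition chain (i j : int) : vectType 'F_2 :=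
  {ffun {t : cone_state | in_cone i j t} -> ('F_2)^o}.

(* cone_diff has bidegree (1, 0); its component from degree i to degree i' is
   the differential for i' = i + 1 and zero otherwise. *)
Definition chain_map (i i' j : int) (f : chain i j) : chain i' j :=
  [ffun y => \sum_x cone_diff (val x) (val y) * f x].

Lemma chain_map_is_linear (i i' j : int) : linear (@chain_map i i' j).
Proof.
move=> a f g; apply/ffunP=> y; rewrite !ffunE scaler_sumr -big_split /=.
by apply: eq_bigr => x _; rewrite !ffunE mulrDr; congr (_ + _); exact: mulrCA.
Qed.

HB.instance Definition _ (i i' j : int) :=
  GRing.isLinear.Build 'F_2 (chain i j) (chain i' j) *:%R (@chain_map i i' j)
    (@chain_map_is_linear i i' j).

Definition d (i i' j : int) : 'Hom(chain i j, chain i' j) :=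
  linfun (@chain_map i i' j).

Definition Kh (i j : int) : zmodType :=
  homology (d (i - 1) i j) (d i (i + 1) j).

End Singular.

(* Main.v *)
Require Import Defs.
From mathcomp Require Import all_boot all_fingroup all_algebra zify.
Set Implicit Arguments.
Unset Strict Implicit.
Unset Printing Implicit Defensive.
Import GRing.Theory.
Local Open Scope ring_scope.

(** Let [b] be the double point of the kink. A state of the cone resolves [b]
to a negative or a positive crossing and then smooths that crossing with or
against the orientation. Against the orientation, a single circle passes
through [b]; call it the trunk. Along the orientation, the loop of the kink is
cut off the trunk and becomes a circle of its own. The part of the differential
that changes the state at [b] is therefore, on the labels of trunk and loop,

   A --Delta--> A (x) A --Delta mu--> A (x) A --mu--> A,

where the outer terms are the smoothings against the orientation, of the
negative crossing on the left and of the positive crossing on the right. Over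
F_2 this sequence is exact: Delta is injective, mu is surjective, and both
Im Delta and Im (Delta mu) equal Ker mu = Ker (Delta mu), which is spanned by
1 (x) x + x (x) 1 and x (x) x. It is even contracted by maps which look only
at the loop: with eps (1) = 0 and eps (x) = 1, they are 1 (x) eps, then
1 (x) eps followed by labelling the loop by 1, then labelling a new loop by 1.

All other components of the differential happen at vertices that the loop does
not meet, so they commute with these three maps. In characteristic 2 they then
cancel from d h + h d, so the three maps form a contracting homotopy h of the
whole cone, and every cycle z is the boundary d (h z).

The proof writes each state as [place k B], where the base [B] is a state of the
leftmost term and the position [k] is one of six: one for each outer term, and
two for each inner term, given by the label of the loop. In these coordinates
[cone_diff_split] and [kink_diffE] say that the differential is the sum of
[diff_id] acting on [k] alone, of [diff_x] acting on [k] together with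
multiplication by x on the trunk, and of the differential of the base.
The homotopy is the transpose of [diff_id], and [homotopy_contraction] comes
down to a check on pairs of positions. *)

(** * Homology and contracting homotopies *)

(** The matrix identity [H M + M H = 1] holds on a basis of all degrees; as [H]
is homogeneous, its entries restrict it to the degrees [P0], [P1], [P2], where
it reads [z = M (H z)] on cycles. *)
Lemma exact_of_contraction (R : comNzRingType) (T : finType) (P0 P1 P2 : pred T)
    (M H : T -> T -> R) :
    (forall x u, P1 x -> H x u != 0 -> P0 u) ->
    (forall w y, P1 y -> H w y != 0 -> P2 w) ->
    (forall x y, P1 x -> P1 y ->
       \sum_u H x u * M u y + \sum_w M x w * H w y = (x == y)%:R) ->
  forall z : {t | P1 t} -> R,
    (forall w : {t | P2 t}, \sum_x M (val x) (val w) * z x = 0) ->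
  forall y, \sum_(u : {t | P0 t}) M (val u) (val y)
              * (\sum_x H (val x) (val u) * z x) = z y.
Proof.
move=> H10 H21 HM z zcycle y.
have sub0 (P : pred T) (F : T -> R) : (forall t, F t != 0 -> P t) ->
    \sum_(t : {t | P t}) F (val t) = \sum_t F t.
  move=> FP; rewrite -(big_sub P) /= [RHS](bigID P) /=.
  rewrite [X in _ + X]big1 ?addr0 //.
  by move=> t; apply: contraNeq; apply: FP.
under eq_bigr => u _ do rewrite mulr_sumr.
rewrite exchange_big /=.
have -> : z y = \sum_x (val x == val y)%:R * z x.
  rewrite (bigD1 y) //= eqxx mul1r big1 ?addr0 // => x /negPf xy.
  by rewrite val_eqE xy mul0r.
apply/eqP; rewrite eq_sym -subr_eq0 -sumrB; apply/eqP.
transitivity (\sum_x \sum_w M (val x) w * H w (val y) * z x).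
  apply: eq_bigr => x _; rewrite -(HM _ _ (valP x) (valP y)) mulrDl.
  rewrite -mulr_suml addrAC.
  rewrite (_ : \sum_(u : {t | P0 t}) _
    = (\sum_u H (val x) u * M u (val y)) * z x).
    by rewrite subrr add0r.
  rewrite -(sub0 P0 (fun u => H (val x) u * M u (val y))); last first.
    move=> u; apply: contraNT => uP; apply/eqP.
    have [->|/(H10 _ _ (valP x))] := eqVneq (H (val x) u) 0.
      by rewrite mul0r.
    by rewrite (negPf uP).
  by rewrite mulr_suml; apply: eq_bigr => u _; rewrite mulrCA mulrA.
rewrite exchange_big /=.
rewrite -(sub0 P2 (fun w => \sum_x M (val x) w * H w (val y) * z x)); last first.
  move=> w; apply: contraNT => wP; apply/eqP/big1 => x _.
  have [->|/(H21 _ _ (valP y))] := eqVneq (H w (val y)) 0.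
    by rewrite mulr0 mul0r.
  by rewrite (negPf wP).
apply: big1 => w _.
transitivity (H (val w) (val y) * (\sum_x M (val x) (val w) * z x)).
  by rewrite mulr_sumr; apply: eq_bigr => x _; rewrite mulrCA mulrA.
by rewrite zcycle mulr0.
Qed.

Lemma homology_eq0 (K : fieldType) (U V W : vectType K)
    (f : 'Hom(U, V)) (g : 'Hom(V, W)) :
  (forall v, g v = 0 -> exists u, v = f u) -> forall h : homology f g, h = 0.
Proof.
move=> fg; elim/quotW => v.
have vI : v - 0 \in (linfun (@vsval K V (lker g)) @^-1: limg f)%VS.
  rewrite subr0 -memv_preim lfunE /=.
  have /fg[u ->] : g (vsval v) = 0.
    by apply/eqP; rewrite -memv_ker; apply: subvsP.
  exact/memv_img/memvf.
move: vI; rewrite Quotient.idealrBE => /eqP ->.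
exact: pi_zeror.
Qed.

(** * The circles near a kink *)

Section Kink.
Variables (G : shadow) (b : G) (r : bool).
Hypothesis glue_b : glue G (b, r) = (b, r).

Lemma edgeK : involutive (@edge G).
Proof.
move=> [v [[] s]]; rewrite /edge.
  case E: (glue G (v, s)) => [w s'] /=.
  by rewrite -E permK.
case E: ((glue G)^-1%g (v, s)) => [w s'] /=.
by rewrite -E permKV.
Qed.

Lemma smoothK (O : {set G}) : involutive (smooth O).
Proof.
by move=> [v [o s]]; rewrite /smooth; case: ifP => /= ->; rewrite negbK.
Qed.

Lemma smoothing_sym (O : {set G}) : symmetric (@smoothing_rel G O).
Proof.
move=> [x|x] [y|y] //=.
by rewrite -!(inv_eq edgeK x) -!(inv_eq (@smoothK O) x) ![_ == y]eq_sym.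
Qed.

Lemma connect_smoothing_sym (O : {set G}) : connect_sym (@smoothing_rel G O).
Proof. exact: sym_connect_sym (@smoothing_sym O). Qed.

Lemma in_circle (O : {set G}) x y :
  (y \in circle O x) = connect (@smoothing_rel G O) x y.
Proof. by rewrite inE. Qed.

Lemma circle_eq (O : {set G}) x y :
  connect (@smoothing_rel G O) x y -> circle O x = circle O y.
Proof.
move=> xy; apply/setP=> z; rewrite !inE.
exact: (same_connect (@connect_smoothing_sym O) xy).
Qed.

Definition loop : {set point G} :=
  [set inl (b, (false, r)); inl (b, (true, r))].

(** A corner of [b] on the trunk and off the loop, on whichever side [r] the kink
lies. *)
Definition base_point : point G := inl (b, (false, ~~ r)).

Lemma edge_loop o : edge (b, (o, r)) = (b, (~~ o, r)) :> corner G.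
Proof. by case: o; rewrite /edge ?glue_b // -{1}glue_b permK. Qed.

Lemma eq_inl (x y : corner G) : (inl x == inl y :> point G) = (x == y).
Proof. by []. Qed.

Lemma in_loop v o s :
  ((inl (v, (o, s)) : point G) \in loop) = (v == b) && (s == r).
Proof.
rewrite !inE !eq_inl !xpair_eqE.
by case: (v == b); case: o; case: (s == r).
Qed.

Lemma base_point_notin : base_point \notin loop.
Proof. by rewrite in_loop eqxx /=; case: (r). Qed.

Lemma edge_in_loop (x : corner G) : (inl (edge x) \in loop) = (inl x \in loop).
Proof.
suff H y : inl y \in loop -> inl (edge y) \in loop.
  by apply/idP/idP => /H //; rewrite edgeK.
case: y => [v [o s]]; rewrite in_loop => /andP[/eqP -> /eqP ->].
by rewrite edge_loop in_loop !eqxx.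
Qed.

Lemma smooth_in_loop (O : {set G}) (x : corner G) : b \in O ->
  (inl (smooth O x) \in loop) = (inl x \in loop).
Proof.
move=> bO; case: x => [v [o s]]; rewrite in_loop /smooth.
case: ifP => vO; rewrite in_loop //.
by case: eqP vO => //= ->; rewrite bO.
Qed.

Lemma smooth_ne (O O' : {set G}) v (x : bool * bool) :
  (v \in O) = (v \in O') -> smooth O (v, x) = smooth O' (v, x).
Proof. by case: x => o s; rewrite /smooth => ->. Qed.

(** The kink joins the two corners of the loop by an edge, and the oriented
smoothing joins them at [b]. *)
Lemma loop_closed (O : {set G}) : b \in O ->
  closed (@smoothing_rel G O) (mem loop).
Proof.
move=> bO [x|x] [y|y] //= /orP[]/eqP ->; apply/esym.
  exact: edge_in_loop.
exact: smooth_in_loop.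
Qed.

Lemma connect_smooth (O : {set G}) x :
  connect (@smoothing_rel G O) (inl x) (inl (smooth O x)).
Proof. by apply: connect1; rewrite /smoothing_rel eqxx orbT. Qed.

Lemma connect_edge (O : {set G}) x :
  connect (@smoothing_rel G O) (inl x) (inl (edge x)).
Proof. by apply: connect1; rewrite /smoothing_rel eqxx. Qed.

Lemma circle_loop (O : {set G}) x : b \in O -> x \in loop -> circle O x = loop.
Proof.
move=> bO xl; apply/setP=> y; rewrite [LHS]inE.
apply/idP/idP => [xy|yl].
  by rewrite -(closed_connect (loop_closed bO) xy).
have E o : connect (@smoothing_rel G O) (inl (b, (o, r))) (inl (b, (~~ o, r))).
  by rewrite -edge_loop connect_edge.
by move: xl yl; rewrite !inE => /orP[] /eqP -> /orP[] /eqP ->;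
  rewrite ?connect0 //; apply: E.
Qed.

(** Cutting the loop off, as a map on the circles of the smoothings against the
orientation at [b]. *)
Definition cut (c : {set point G}) : {set point G} := c :\: loop.

Section Unoriented.
Variable O : {set G}.
Hypothesis bO : b \notin O.

Lemma smooth_turn o s : smooth O (b, (o, s)) = (b, (o, ~~ s)).
Proof. by rewrite /smooth (negbTE bO). Qed.

Lemma smooth_through o s : smooth (b |: O) (b, (o, s)) = (b, (~~ o, s)).
Proof. by rewrite /smooth setU11. Qed.

Lemma smooth_setU1 v (x : bool * bool) : v != b ->
  smooth (b |: O) (v, x) = smooth O (v, x).
Proof. by move=> vb; apply: smooth_ne; rewrite !inE (negbTE vb). Qed.

(** Against the orientation, the smoothing leads from each half of the kink
onto the loop, and the edge of the kink leads through it. *)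
Lemma connect_at_b x y :
  connect (@smoothing_rel G O) (inl (b, x)) (inl (b, y)).
Proof.
have C o s :
    connect (@smoothing_rel G O) (inl (b, (o, s))) (inl (b, (o, ~~ s))).
  by rewrite -smooth_turn connect_smooth.
have C' o s : connect (@smoothing_rel G O) (inl (b, (o, s))) (inl (b, (o, r))).
  have [<-|] := eqVneq s r; first by rewrite connect0.
  by have := C o s; case: s; case: r.
case: x y => [o s] [o' s'].
apply: connect_trans (C' o s) _; rewrite connect_smoothing_sym.
apply: connect_trans (C' o' s') _.
have [->|oo'] := eqVneq o o'; first exact: connect0.
have -> : o' = ~~ o by case: o o' oo' => [] [].
by rewrite -edge_loop connect_smoothing_sym connect_edge.
Qed.

Lemma connect_setU1_sub x y :
  connect (@smoothing_rel G (b |: O)) x y -> connect (@smoothing_rel G O) x y.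
Proof.
apply: connect_sub => {x y} [[x|x] [y|y]] //= /orP[]/eqP ->.
  exact: connect_edge.
case: x => [v x]; have [->|vb] := eqVneq v b.
  by case: x => o s; rewrite smooth_through connect_at_b.
by rewrite smooth_setU1 // connect_smooth.
Qed.

(** Contracts the loop to a point of the rest of the trunk: the retraction is
compatible with both smoothings, so it carries paths back. *)
Definition retract (x : point G) := if x \in loop then base_point else x.

Lemma connect_retract x y :
  connect (@smoothing_rel G O) x y ->
  connect (@smoothing_rel G (b |: O)) (retract x) (retract y).
Proof.
case/connectP => p + ->; elim: p x => [|y' p IH] x //=.
case/andP=> xy' /IH; apply: connect_trans => {IH p}.
case: x y' xy' => [x|x] [y'|y'] //= /orP[]/eqP ->; rewrite /retract.
  by rewrite edge_in_loop; case: ifP; rewrite ?connect0 ?connect_edge.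
case: x => v x; have [->|vb] := eqVneq v b; last first.
  rewrite -[smooth O _]smooth_setU1 // smooth_in_loop ?setU11 //.
  by case: ifP; rewrite ?connect0 ?connect_smooth.
case: x => o s; rewrite smooth_turn !in_loop eqxx /=.
have C o' :
    connect (@smoothing_rel G (b |: O)) base_point (inl (b, (o', ~~ r))).
  case: o'; last exact: connect0.
  have := connect_smooth (b |: O) (b, (false, ~~ r)).
  by rewrite smooth_through.
have [->|] := eqVneq s r; first by case: (r) (C o) => /=.
move=> sr; have -> : s = ~~ r by case: s (r) sr => [] [].
by rewrite negbK eqxx connect_smoothing_sym.
Qed.

(** Smoothing the kink along its orientation cuts the loop off the circle
through it and leaves the rest of the picture unchanged. *)
Lemma circle_setU1 x : x \notin loop -> circle (b |: O) x = cut (circle O x).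
Proof.
move=> xl; apply/setP=> y; rewrite in_setD !in_circle.
have [yl|yl] := boolP (y \in loop).
  apply/negP => /(closed_connect (loop_closed (setU11 b O))) E.
  by case/negP: xl; rewrite E.
apply/idP/idP => /=; first exact: connect_setU1_sub.
by move=> /connect_retract; rewrite /retract (negPf xl) (negPf yl).
Qed.

Definition trunk : {set point G} := circle O base_point.

Lemma circle_b x : circle O (inl (b, x)) = trunk.
Proof. exact: circle_eq (connect_at_b _ _). Qed.

End Unoriented.

(** A set of points that follows the trunk contains the loop as soon as it
contains the rest of the trunk, as the circles of a smoothing do when the kink
is smoothed against its orientation. On such sets [cut] loses nothing. *)
Definition follows_trunk (c : {set point G}) : bool :=
  [forall y in loop, (y \in c) == (base_point \in c)].

Definition followers : {set {set point G}} := [set c | follows_trunk c].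

Lemma cut_inj : {in followers &, injective cut}.
Proof.
move=> c c'; rewrite !inE => /forall_inP fc /forall_inP fc' cc'; apply/setP=> y.
have H z : z \notin loop -> (z \in c) = (z \in c').
  by move=> zl; move/setP/(_ z): cc'; rewrite !in_setD zl.
have [yl|/H //] := boolP (y \in loop).
by rewrite (eqP (fc y yl)) (eqP (fc' y yl)) H // base_point_notin.
Qed.

Lemma cut_id c : c \in followers -> base_point \notin c -> cut c = c.
Proof.
rewrite inE => /forall_inP fc bc; apply/setP=> y; rewrite in_setD.
by case: (boolP (y \in loop)) => // /fc /eqP ->; rewrite (negPf bc).
Qed.

Lemma cut_neq_loop c : cut c != loop.
Proof.
apply/negP => /eqP /setP /(_ (inl (b, (false, r)))).
by rewrite in_setD in_loop !eqxx.
Qed.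

Lemma circles_followers (O : {set G}) : b \notin O ->
  circles O \subset followers.
Proof.
move=> bO; apply/subsetP=> _ /imsetP[x _ ->]; rewrite inE; apply/forall_inP=> y.
rewrite !in_circle => yl; apply/eqP/esym.
apply: same_connect_r; first exact: connect_smoothing_sym.
by move: yl; rewrite !inE => /orP[]/eqP ->; apply: connect_at_b.
Qed.

Lemma circles_base_point (O : {set G}) c : c \in circles O ->
  (base_point \in c) = (c == trunk O).
Proof.
case/imsetP=> x _ ->; rewrite in_circle; apply/idP/eqP => [/circle_eq //|E].
by rewrite -in_circle E in_circle connect0.
Qed.

Lemma circles_setU1 (O : {set G}) : b \notin O ->
  circles (b |: O) = loop |: cut @: circles O.
Proof.
move=> bO; apply/setP=> c; rewrite in_setU1; apply/imsetP/idP.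
  case=> x _ ->; have [xl|xl] := boolP (x \in loop).
    by rewrite circle_loop ?eqxx ?setU11.
  by rewrite circle_setU1 // !imset_f ?orbT.
case/orP=> [/eqP ->|/imsetP[_ /imsetP[x _ ->] ->]].
  exists (inl (b, (false, r))) => //.
  by rewrite (circle_loop (setU11 b O)) // in_loop !eqxx.
have [xl|xl] := boolP (x \in loop); last first.
  by exists x => //; rewrite circle_setU1.
exists base_point => //; rewrite circle_setU1 ?base_point_notin //.
by congr cut; move: xl; rewrite !inE => /orP[] /eqP ->; rewrite circle_b.
Qed.

(** * Saddles and genus-1 maps near a kink *)

Implicit Types X Y Z : {set {set point G}}.

(** The labelled circles [X] are carried over to the oriented smoothing at [b],
with the loop labelled by [e]. *)
Definition with_loop (e : bool) X :=
  if e then loop |: cut @: X else cut @: X.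

Lemma loop_in_with_loop e X : (loop \in with_loop e X) = e.
Proof.
have H : loop \notin cut @: X.
  by apply/imsetP=> -[c _ E]; case/eqP: (cut_neq_loop c).
by rewrite /with_loop; case: e; rewrite ?setU11 // (negPf H).
Qed.

Lemma cut_in_with_loop e X c : X \subset followers -> c \in followers ->
  (cut c \in with_loop e X) = (c \in X).
Proof.
move=> XF cF; have -> : (cut c \in with_loop e X) = (cut c \in cut @: X).
  rewrite /with_loop; case: e => //.
  by rewrite in_setU1 (negPf (cut_neq_loop c)).
apply/imsetP/idP => [[c' c'X E]|cX]; last by exists c.
by rewrite (cut_inj cF (subsetP XF _ c'X) E).
Qed.

Lemma eq_with_loop e e' X Y : X \subset followers -> Y \subset followers ->
  (with_loop e X == with_loop e' Y) = (e == e') && (X == Y).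
Proof.
move=> XF YF; apply/eqP/andP => [E|[/eqP -> /eqP ->] //].
have ee' : e = e' by rewrite -(loop_in_with_loop e X) E loop_in_with_loop.
split; first exact/eqP.
apply/eqP/setP=> c; have [cF|cF] := boolP (c \in followers).
  by rewrite -(cut_in_with_loop e XF cF) E cut_in_with_loop.
by apply/idP/idP => [/(subsetP XF)|/(subsetP YF)]; rewrite (negPf cF).
Qed.

Lemma with_loop_setD e X Z : X \subset followers -> Z \subset followers ->
  with_loop e X :\: cut @: Z = with_loop e (X :\: Z).
Proof.
move=> XF ZF; have H : cut @: X :\: cut @: Z = cut @: (X :\: Z).
  apply/setP=> c; rewrite in_setD; apply/andP/imsetP.
    case=> nZ /imsetP[c' c'X E]; exists c' => //; rewrite in_setD c'X andbT.
    by apply: contra nZ => c'Z; rewrite E imset_f.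
  case=> c'; rewrite in_setD => /andP[nZ c'X] ->; split; last exact: imset_f.
  rewrite -[cut @: Z]/(with_loop false Z) cut_in_with_loop //.
  exact: (subsetP XF).
rewrite /with_loop; case: e => //; rewrite setDUl H; congr (_ :|: _).
apply/setDidPl; rewrite disjoints1.
by rewrite -[cut @: _]/(with_loop false _) loop_in_with_loop.
Qed.

Lemma strand1_setU1 (O : {set G}) v : b \notin O -> v != b ->
  strand1 (b |: O) v = cut (strand1 O v).
Proof. by move=> bO vb; apply: circle_setU1; rewrite // in_loop (negPf vb). Qed.

Lemma strand2_setU1 (O : {set G}) v : b \notin O -> v != b ->
  strand2 (b |: O) v = cut (strand2 O v).
Proof. by move=> bO vb; apply: circle_setU1; rewrite // in_loop (negPf vb). Qed.

Lemma circle_in_followers (O : {set G}) x : b \notin O ->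
  circle O x \in followers.
Proof.
by move=> bO; apply: (subsetP (circles_followers bO)); apply: imset_f.
Qed.

Lemma pair_followers (c c' : {set point G}) :
  c \in followers -> c' \in followers ->
  [set c; c'] \subset followers.
Proof. by move=> cF c'F; rewrite subUset !sub1set cF. Qed.

Lemma cut_pair c c' : [set cut c; cut c'] = cut @: [set c; c'].
Proof. by rewrite imsetU !imset_set1. Qed.

(** The strands at any other vertex avoid the loop, and [cut] identifies the
remaining circles, so such a saddle acts as if the loop were not there. *)
Lemma saddle_with_loop (O O' : {set G}) v e e' X Y :
    b \notin O -> b \notin O' -> v != b ->
    X \subset followers -> Y \subset followers ->
  saddle v (b |: O) (b |: O') (with_loop e X) (with_loop e' Y)
    = if e == e' then saddle v O O' X Y else 0.
Proof.
move=> bO bO' vb XF YF; rewrite /saddle !strand1_setU1 ?strand2_setU1 //.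
have F1 := circle_in_followers (inl (v, (false, false))) bO.
have F2 := circle_in_followers (inl (v, (true, true))) bO.
have F1' := circle_in_followers (inl (v, (false, false))) bO'.
have F2' := circle_in_followers (inl (v, (true, true))) bO'.
rewrite !cut_pair !with_loop_setD ?pair_followers //.
rewrite eq_with_loop ?(subset_trans (subsetDl _ _)) //.
rewrite !cut_in_with_loop // !(inj_in_eq cut_inj) //.
by case: (e == e').
Qed.

Lemma genus1_with_loop (O : {set G}) v e e' X Y :
    b \notin O -> v != b -> X \subset followers -> Y \subset followers ->
  genus1 v (b |: O) (with_loop e X) (with_loop e' Y)
    = if e == e' then genus1 v O X Y else 0.
Proof.
move=> bO vb XF YF; rewrite /genus1 !strand1_setU1 ?strand2_setU1 //.
have F1 := circle_in_followers (inl (v, (false, false))) bO.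
have F2 := circle_in_followers (inl (v, (true, true))) bO.
rewrite !cut_pair !with_loop_setD ?pair_followers //.
rewrite eq_with_loop ?(subset_trans (subsetDl _ _)) //.
rewrite !cut_in_with_loop // !(inj_in_eq cut_inj) //.
by case: (e == e').
Qed.

Section AtKink.
Variable O : {set G}.
Hypothesis bO : b \notin O.

(** Multiplication by x on the label of the trunk, sending 1 to x and x to 0. *)
Definition mulx X Y : bool := (trunk O \notin X) && (Y == trunk O |: X).

(** This and [mulx_off_trunk] bring equality and [mulx] to the form of the
saddles: agreement away from the trunk and a condition on its label. *)
Lemma eq_off_trunk X Y :
  (X == Y) = (X :\ trunk O == Y :\ trunk O)
    && ((trunk O \in X) == (trunk O \in Y)).
Proof.
apply/eqP/andP => [-> //|[/eqP/setP E /eqP e]]; apply/setP=> c.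
by have := E c; rewrite !in_setD1; have [->|] := eqVneq c (trunk O).
Qed.

Lemma mulx_off_trunk X Y :
  mulx X Y
    = [&& X :\ trunk O == Y :\ trunk O, trunk O \notin X & trunk O \in Y].
Proof.
rewrite /mulx; have [tX|tX] := boolP (trunk O \in X).
  by rewrite andbF.
rewrite (eq_off_trunk Y) setU11 setU1K // eqb_id [Y :\ _ == _]eq_sym /=.
have /setDidPl -> // : [disjoint X & [set trunk O]].
by rewrite disjoint_sym disjoints1.
Qed.

(** Which of the two strands is the loop depends on the side [r] of the kink. *)
Lemma strands_kink :
  [/\ strand1 O b = trunk O, strand2 O b = trunk O &
      (strand1 (b |: O) b, strand2 (b |: O) b)
      = if r then (cut (trunk O), loop) else (loop, cut (trunk O))].
Proof.
split; [exact: circle_b | exact: circle_b |].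
rewrite /strand1 /strand2 /trunk -circle_setU1 ?base_point_notin //.
rewrite /base_point; case E: r => /=; congr (_, _).
- by apply: circle_loop; rewrite ?setU11 // -E in_loop !eqxx.
- by apply: circle_loop; rewrite ?setU11 // -E in_loop !eqxx.
- apply/esym/circle_eq.
  by have := connect_smooth (b |: O) (b, (false, true)); rewrite smooth_through.
Qed.

Lemma with_loop_off_trunk e X : X \subset circles O ->
  with_loop e X :\: [set cut (trunk O); loop] = X :\ trunk O.
Proof.
move=> XO; have XF := subset_trans XO (circles_followers bO).
have tF : trunk O \in followers by apply: circle_in_followers.
rewrite -setDDl -imset_set1 with_loop_setD ?sub1set //.
have F c : c \in X :\ trunk O -> cut c = c.
  rewrite in_setD1 => /andP[ct cX]; apply: cut_id; first exact: (subsetP XF).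
  by rewrite (circles_base_point (subsetP XO _ cX)).
have E : cut @: (X :\ trunk O) = X :\ trunk O.
  by rewrite (eq_in_imset F) imset_id.
rewrite -[RHS]E; have H := loop_in_with_loop false (X :\ trunk O).
apply/setP=> c; rewrite in_setD1 /with_loop.
case: (eqVneq c loop) => [->|cl] /=.
  by rewrite -[LHS]H.
by case: e; rewrite ?in_setU1 ?(negPf cl).
Qed.

(** Delta (p) = p (x) x + (x p) (x) 1, the loop being the second factor. *)
Lemma saddle_split e X Y : X \subset circles O -> Y \subset circles O ->
  saddle b O (b |: O) X (with_loop e Y) = (if e then X == Y else mulx X Y)%:R.
Proof.
move=> XO YO; have YF := subset_trans YO (circles_followers bO).
have tF : trunk O \in followers by apply: circle_in_followers.
have [E1 E2 E3] := strands_kink; rewrite /saddle E1 E2.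
rewrite mulx_off_trunk [X == Y]eq_off_trunk.
have H := cut_in_with_loop e YF tF; have H' := loop_in_with_loop e Y.
move: E3; case: (r) => -[-> ->]; rewrite ?[[set loop; _]]setUC;
  rewrite with_loop_off_trunk // setUid eqxx /=.
all: rewrite ?[loop == _]eq_sym cut_neq_loop H H'.
all: case: (_ :\ _ == _ :\ _); case: (_ \in X); case: (_ \in Y); case: (e).
all: by [].
Qed.

(** mu (p (x) 1) = p and mu (p (x) x) = x p. *)
Lemma saddle_merge e X Y : X \subset circles O -> Y \subset circles O ->
  saddle b (b |: O) O (with_loop e X) Y = (if e then mulx X Y else X == Y)%:R.
Proof.
move=> XO YO; have XF := subset_trans XO (circles_followers bO).
have tF : trunk O \in followers by apply: circle_in_followers.
have [E1 E2 E3] := strands_kink; rewrite /saddle E1 E2.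
rewrite mulx_off_trunk [X == Y]eq_off_trunk.
have H := cut_in_with_loop e XF tF; have H' := loop_in_with_loop e X.
move: E3; case: (r) => -[-> ->]; rewrite ?[[set loop; _]]setUC;
  rewrite with_loop_off_trunk // setUid eqxx /=.
all: rewrite ?[loop == _]eq_sym cut_neq_loop H H'.
all: case: (_ :\ _ == _ :\ _); case: (_ \in X); case: (_ \in Y); case: (e).
all: by [].
Qed.

(** Delta mu sends p (x) 1 to p (x) x + (x p) (x) 1. It sends p (x) x to
(x p) (x) x, as x^2 = 0. *)
Lemma genus1_kink e e' X Y : X \subset circles O -> Y \subset circles O ->
  genus1 b (b |: O) (with_loop e X) (with_loop e' Y)
    = (if e' then if e then mulx X Y else X == Y else ~~ e && mulx X Y)%:R.
Proof.
move=> XO YO; have XF := subset_trans XO (circles_followers bO).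
have YF := subset_trans YO (circles_followers bO).
have tF : trunk O \in followers by apply: circle_in_followers.
have [_ _ E3] := strands_kink; rewrite /genus1.
rewrite mulx_off_trunk [X == Y]eq_off_trunk.
have HX := cut_in_with_loop e XF tF; have HX' := loop_in_with_loop e X.
have HY := cut_in_with_loop e' YF tF; have HY' := loop_in_with_loop e' Y.
move: E3; case: (r) => -[-> ->]; rewrite ?[[set loop; _]]setUC;
  rewrite !with_loop_off_trunk //=.
all: rewrite ?[loop == _]eq_sym cut_neq_loop HX HX' HY HY'.
all: rewrite big_bool.
all: case: (_ :\ _ == _ :\ _); case: (_ \in X); case: (_ \in Y).
all: case: (e) (e') => [] [].
all: by rewrite /= ?big_bool; apply/eqP.
Qed.

End AtKink.
End Kink.

(** * States of the cone, relative to the kink *)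

Lemma sum_split (V : nmodType) (T : finType) (b : T) (P : pred T) (F : T -> V) :
  \sum_(c | P c) F c
    = (if P b then F b else 0) + \sum_(c | (c != b) && P c) F c.
Proof.
case: ifP => Pb; last first.
  by rewrite add0r; apply: eq_bigl => c; case: eqP => //= ->.
by rewrite (bigD1 b) //=; congr (_ + _); apply: eq_bigl => c; rewrite andbC.
Qed.

Section Insert.
Variables (T : finType) (b : T).
Implicit Types s : {set T}.

Definition insert (e : bool) s := if e then b |: s else s.

Lemma mem_insert e s : b \notin s -> (b \in insert e s) = e.
Proof. by case: e => /= [|/negPf]; rewrite ?setU11. Qed.

Lemma in_insert e s c : c != b -> (c \in insert e s) = (c \in s).
Proof. by case: e => //= /negPf cb; rewrite in_setU1 cb. Qed.

Lemma insert_setD1 s : insert (b \in s) (s :\ b) = s.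
Proof.
case: (boolP (b \in s)) => /= bs; first by rewrite setD1K.
by apply/setDidPl; rewrite disjoint_sym disjoints1.
Qed.

Lemma eq_insert e e' s s' : b \notin s -> b \notin s' ->
  (insert e s == insert e' s') = (e == e') && (s == s').
Proof.
move=> bs bs'; apply/eqP/andP => [E|[/eqP -> /eqP ->] //].
split; first by rewrite -(mem_insert e bs) E mem_insert.
apply/eqP/setP=> c; have [->|cb] := eqVneq c b.
  by rewrite (negPf bs) (negPf bs').
by rewrite -(in_insert e s cb) E in_insert.
Qed.

Lemma insert_setU1 e s c : c |: insert e s = insert e (c |: s).
Proof. by case: e => //=; rewrite setUCA. Qed.

Lemma insert_setD e s c : c != b -> insert e s :\ c = insert e (s :\ c).
Proof.
case: e => //= cb; rewrite setDUl; congr (_ :|: _).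
by apply/setDidPl; rewrite disjoints1 in_set1 eq_sym.
Qed.

Lemma setU1_insert e s : b |: insert e s = insert true s.
Proof. by case: e => //=; rewrite setUA setUid. Qed.

Lemma setD1_insert e s : b \notin s -> insert e s :\ b = insert false s.
Proof.
case: e => /= bs; first by rewrite setU1K.
by apply/setDidPl; rewrite disjoint_sym disjoints1.
Qed.

Lemma card_insert e s : b \notin s -> #|insert e s| = (e + #|s|)%N.
Proof. by case: e => //= bs; rewrite cardsU1 bs. Qed.

End Insert.

(** How a state looks at the kink. With the double point resolved to a positive
([p = true]) or negative crossing, [inl p] stands for the smoothing against the
orientation; [inr (p, e)] stands for the oriented one, where the loop of the
kink is a circle of its own, labelled by x ([e = true]) or 1. *)
Definition position : finType := (bool + bool * bool)%type.

Definition resolved (k : position) : bool :=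
  match k with inl p => p | inr (p, _) => p end.
Definition smoothed (k : position) : bool :=
  match k with inl p => p | inr (p, _) => ~~ p end.
Definition oriented (k : position) : bool := if k is inr _ then true else false.

(** The sequence A -> A (x) A -> A (x) A -> A of the kink is
[1 (x) diff_id + x (x) diff_x], where the first factor is the label of the
trunk. As a graph on positions, [diff_id] is a perfect matching. *)
Definition diff_id (k k' : position) : bool :=
  match k, k' with
  | inl false, inr (false, true)
  | inr (false, false), inr (true, true)
  | inr (true, false), inl true => true
  | _, _ => false
  end.

Definition diff_x (k k' : position) : bool :=
  match k, k' with
  | inl false, inr (false, false)
  | inr (true, true), inl true => true
  | inr (false, e), inr (true, e') => e == e'
  | _, _ => false
  end.

Section Cone.
Variables (D : singular_diagram) (b : D) (r : bool).
Hypothesis double_b : b \in double_points D.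
Hypothesis glue_b : glue D (b, r) = (b, r).

Implicit Types (k : position) (t B : cone_state D).

Definition state_smoothing (t : cone_state D) : {set D} :=
  oriented_at (resolution t.1) t.2.1.

Definition labelling (k : position) (X : {set {set point D}}) :=
  if k is inr (_, e) then with_loop b r e X else X.

Definition place (k : position) (B : cone_state D) : cone_state D :=
  (insert b (resolved k) B.1,
   (insert b (smoothed k) B.2.1, labelling k B.2.2)).

Definition is_state (t : cone_state D) : bool :=
  (t.1 \subset double_points D) && (t.2.2 \subset circles (state_smoothing t)).

(** The bases are the states at position [inl false]. *)
Definition is_base (B : cone_state D) : bool :=
  [&& is_state B, b \notin B.1 & b \notin B.2.1].

(** Both changing the sign of [b] and changing its membership in the state turn
its smoothing. *)
Lemma smoothing_insert p e (S s : {set D}) : b \notin S -> b \notin s ->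
  oriented_at (resolution (insert b p S)) (insert b e s)
    = insert b (p != e) (oriented_at (resolution S) s).
Proof.
move=> bS bs; apply/setP=> v; have [->|vb] := eqVneq v b.
  have kb : kind b = Double.
    by move: double_b; rewrite inE; case: (kind b).
  have bO : b \notin oriented_at (resolution S) s.
    by rewrite !inE kb (negPf bS) (negPf bs).
  by rewrite mem_insert // !inE kb !mem_insert // eq_sym.
by rewrite in_insert // !inE !in_insert.
Qed.

Lemma smoothing_place k B : b \notin B.1 -> b \notin B.2.1 ->
  state_smoothing (place k B) = insert b (oriented k) (state_smoothing B).
Proof.
move=> bS bs; rewrite /state_smoothing smoothing_insert //.
by case: k => [[]|[[] e]].
Qed.

Lemma base_smoothing B : is_base B -> b \notin state_smoothing B.
Proof.
case/and3P=> _ bS bs; have kb : kind b = Double.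
  by move: double_b; rewrite inE; case: (kind b).
by rewrite !inE kb (negPf bS) (negPf bs).
Qed.

Lemma base_followers B : is_base B -> B.2.2 \subset followers b r.
Proof.
move=> HB; case/and3P: (HB) => /andP[_ XO] _ _.
exact: subset_trans XO (circles_followers glue_b (base_smoothing HB)).
Qed.

Lemma eq_place k k' B B' : is_base B -> is_base B' ->
  (place k B == place k' B') = (k == k') && (B == B').
Proof.
move=> HB HB'; have XF := base_followers HB; have XF' := base_followers HB'.
case/and3P: HB => _ bS bs; case/and3P: HB' => _ bS' bs'.
case: B B' bS bs bS' bs' XF XF' => [S [s X]] [S' [s' X']] /=.
move=> bS bs bS' bs' XF XF'.
rewrite /place !xpair_eqE /= !eq_insert //.
case: k k' => [p|[p e]] [p' |[p' e']] /=.
- by rewrite -[inl p == _]/(p == p'); case: (p == p'); rewrite /= ?andbF.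
- by case: (p) (p') => [] []; rewrite /= ?andbF.
- by case: (p) (p') => [] []; rewrite /= ?andbF.
rewrite eq_with_loop // -[inr _ == _]/((p, e) == (p', e')) xpair_eqE.
by case: (p) (p') => [] []; case: (e == e'); rewrite /= ?andbF.
Qed.

(** Where the loop is a circle, the labels of the base are pulled back along
[cut]. *)
Lemma state_place t : is_state t -> exists k B, is_base B /\ t = place k B.
Proof.
case: t => [S [s X]] /andP[/= Sd XO].
pose S0 := S :\ b; pose s0 := s :\ b.
have bS0 : b \notin S0 by rewrite !inE eqxx.
have bs0 : b \notin s0 by rewrite !inE eqxx.
have S0d : S0 \subset double_points D := subset_trans (subsetDl _ _) Sd.
pose O0 := oriented_at (resolution S0) s0.
have EO : oriented_at (resolution S) s = insert b ((b \in S) != (b \in s)) O0.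
  by rewrite -smoothing_insert // !insert_setD1.
rewrite /state_smoothing /= EO in XO.
have bO0 : b \notin O0.
  apply: (@base_smoothing (S0, (s0, set0))).
  by rewrite /is_base /is_state /= S0d sub0set bS0.
have [ESs|NSs] := eqVneq (b \in S) (b \in s).
  exists (inl (b \in S)), (S0, (s0, X)); split.
    rewrite ESs eqxx in XO.
    by rewrite /is_base /is_state /= S0d bS0 bs0 XO.
  by rewrite /place /= {2}ESs !insert_setD1.
rewrite NSs /= (circles_setU1 glue_b) // in XO.
pose X0 := [set c in circles O0 | cut b r c \in X].
have X0O : X0 \subset circles O0 by apply/subsetP=> c; rewrite inE => /andP[].
exists (inr (b \in S, loop b r \in X)), (S0, (s0, X0)); split.
  by rewrite /is_base /is_state /= S0d bS0 bs0 X0O.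
have -> : X = with_loop b r (loop b r \in X) X0.
  apply/setP=> c; apply/idP/idP => [cX|].
    move/subsetP: XO => /(_ c cX); rewrite in_setU1 => /orP[/eqP E|].
      by rewrite E loop_in_with_loop // -E cX.
    case/imsetP=> c' c'O E; rewrite E cut_in_with_loop //.
    - by rewrite inE c'O -E.
    - exact: subset_trans X0O (circles_followers glue_b bO0).
    - exact: (subsetP (circles_followers glue_b bO0)) c'O.
  rewrite /with_loop; case: ifP => lX; rewrite ?in_setU1.
    by case/orP=> [/eqP -> //|/imsetP[c']]; rewrite inE => /andP[_ H] ->.
  by case/imsetP=> c'; rewrite inE => /andP[_ H] ->.
rewrite /place /= loop_in_with_loop // insert_setD1; congr (_, (_, _)).
have -> : ~~ (b \in S) = (b \in s) by case: (b \in S) (b \in s) NSs => [] [].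
by rewrite insert_setD1.
Qed.

Definition mul_trunk B B' : bool :=
  [&& B'.1 == B.1, B'.2.1 == B.2.1
    & mulx b r (state_smoothing B) B.2.2 B'.2.2].

Lemma position_eq k k' : resolved k = resolved k' -> smoothed k = smoothed k' ->
  [\/ exists2 p, k = inl p & k' = inl p
    | exists p e e', k = inr (p, e) /\ k' = inr (p, e')].
Proof.
case: k k' => [p|[p e]] [p'|[p' e']] /= -> E; try by case: (p') E.
  by left; exists p'.
by right; exists p', e, e'.
Qed.

(** Away from [b] the differential does not see the position of the kink. *)
Lemma saddle_place c k k' B B' : is_base B -> is_base B' -> c != b ->
    resolved k = resolved k' -> smoothed k = smoothed k' ->
  saddle c (state_smoothing (place k B)) (state_smoothing (place k' B'))
      (labelling k B.2.2) (labelling k' B'.2.2)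
    = if k == k' then
        saddle c (state_smoothing B) (state_smoothing B') B.2.2 B'.2.2
      else 0.
Proof.
move=> HB HB' cb Er Es.
case/and3P: (HB) => _ bS bs; case/and3P: (HB') => _ bS' bs'.
rewrite !smoothing_place //.
case: (position_eq Er Es) => [[p -> ->]|[p [e [e' [-> ->]]]]].
  by rewrite eqxx.
rewrite /= (saddle_with_loop glue_b) ?base_smoothing ?base_followers //.
by rewrite -[inr _ == _]/((p, e) == (p, e')) xpair_eqE eqxx.
Qed.

Lemma genus1_place c k k' B B' : is_base B -> is_base B' -> c != b ->
    resolved k = resolved k' -> smoothed k = smoothed k' ->
  genus1 c (state_smoothing (place k B)) (labelling k B.2.2)
      (labelling k' B'.2.2)
    = if k == k' then genus1 c (state_smoothing B) B.2.2 B'.2.2 else 0.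
Proof.
move=> HB HB' cb Er Es.
case/and3P: (HB) => _ bS bs; case/and3P: (HB') => _ bS' bs'.
rewrite !smoothing_place //.
case: (position_eq Er Es) => [[p -> ->]|[p [e [e' [-> ->]]]]].
  by rewrite eqxx.
rewrite /= (genus1_with_loop glue_b) ?base_smoothing ?base_followers //.
by rewrite -[inr _ == _]/((p, e) == (p, e')) xpair_eqE eqxx.
Qed.

Lemma setU1_neq (s s' : {set D}) : b \notin s' -> (s' == b |: s) = false.
Proof. by move=> bs'; apply: contraNF bs' => /eqP ->; rewrite setU11. Qed.

Lemma diff_at_b (P : {set D}) (e e' : enhanced_state D) :
  diff P e e' = (if b \notin e.1 then
      if e'.1 == b |: e.1
      then saddle b (oriented_at P e.1) (oriented_at P e'.1) e.2 e'.2 else 0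
      else 0)
    + \sum_(c | (c != b) && (c \notin e.1))
        (if e'.1 == c |: e.1
         then saddle c (oriented_at P e.1) (oriented_at P e'.1) e.2 e'.2
         else 0).
Proof. exact: sum_split. Qed.

Lemma cone_diff_at_b t t' :
  cone_diff t t' = (if t'.1 == t.1 then diff (resolution t.1) t.2 t'.2 else 0)
    + ((if b \in double_points D :\: t.1 then
          if t'.1 == b |: t.1 then Phi (resolution t.1) b t.2 t'.2 else 0
        else 0)
       + \sum_(c | (c != b) && (c \in double_points D :\: t.1))
           (if t'.1 == c |: t.1 then Phi (resolution t.1) c t.2 t'.2 else 0)).
Proof. by congr (_ + _); apply: sum_split. Qed.

Lemma diff_place k k' B B' : is_base B -> is_base B' ->
    B'.1 = B.1 -> resolved k' = resolved k ->
  diff (resolution (place k B).1) (place k B).2 (place k' B').2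
    = (if ~~ smoothed k && (smoothed k' && (B'.2.1 == B.2.1)) then
         saddle b (state_smoothing (place k B)) (state_smoothing (place k' B'))
           (labelling k B.2.2) (labelling k' B'.2.2) else 0)
      + (if k == k' then diff (resolution B.1) B.2 B'.2 else 0).
Proof.
move=> HB HB' ES Er.
case/and3P: (HB) => _ bS bs; case/and3P: (HB') => _ bS' bs'.
have EP : (place k' B').1 = (place k B).1 by rewrite /place /= ES Er.
rewrite !diff_at_b.
rewrite (setU1_neq B.2.1 bs') if_same add0r.
congr (_ + _).
  rewrite /state_smoothing EP setU1_insert eq_insert // mem_insert // eqb_id.
  by rewrite !if_and.
have -> (x : 'F_2) : (if k == k' then x else 0) = x *+ (k == k').
  by case: (k == k').
rewrite -sumrMnl; apply: eq_big => c.
  by case: eqP => //= /eqP cb; rewrite in_insert.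
case/andP=> cb _; rewrite insert_setU1 eq_insert //; last first.
  by rewrite in_setU1 negb_or eq_sym cb.
have [Es|Es] := eqVneq (smoothed k') (smoothed k); last first.
  have -> : (k == k') = false by apply: contraNF Es => /eqP ->.
  by rewrite mulr0n.
case: (B'.2.1 == _) => /=; last by rewrite mul0rn.
have := saddle_place HB HB' cb (esym Er) (esym Es).
rewrite /state_smoothing EP ES => ->.
by case: (k == k').
Qed.

Lemma Phi_place c k k' B B' : is_base B -> is_base B' -> c != b ->
    resolved k' = resolved k ->
  Phi (resolution (place k B).1) c (place k B).2 (place k' B').2
    = if k == k' then Phi (resolution B.1) c B.2 B'.2 else 0.
Proof.
move=> HB HB' cb Er.
case/and3P: (HB) => _ bS bs; case/and3P: (HB') => _ bS' bs'.
rewrite /Phi in_insert // insert_setD // eq_insert //; last first.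
  by rewrite in_setD negb_and bs orbT.
have [Es|Es] := eqVneq (smoothed k') (smoothed k); last first.
  have -> : (k == k') = false by apply: contraNF Es => /eqP ->.
  by rewrite andbF.
case: (_ && _); last by case: (k == k').
exact: genus1_place.
Qed.

Definition kink_diff k k' B B' : 'F_2 :=
  if (B'.1 == B.1) && (B'.2.1 == B.2.1) then
    if [&& resolved k' == resolved k, ~~ smoothed k & smoothed k'] then
      saddle b (state_smoothing (place k B)) (state_smoothing (place k' B'))
        (labelling k B.2.2) (labelling k' B'.2.2)
    else if [&& ~~ resolved k, resolved k', smoothed k & ~~ smoothed k'] then
      genus1 b (state_smoothing (place k B)) (labelling k B.2.2)
        (labelling k' B'.2.2)
    else 0
  else 0.

Lemma Phi_kink k k' B B' : is_base B -> is_base B' ->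
  (if (place k' B').1 == b |: (place k B).1
   then Phi (resolution (place k B).1) b (place k B).2 (place k' B').2 else 0)
  = if (B'.1 == B.1) && (B'.2.1 == B.2.1) then
      if [&& resolved k', smoothed k & ~~ smoothed k'] then
        genus1 b (state_smoothing (place k B)) (labelling k B.2.2)
          (labelling k' B'.2.2)
      else 0
    else 0.
Proof.
move=> HB HB'; case/and3P: (HB) => _ bS bs; case/and3P: (HB') => _ bS' bs'.
rewrite setU1_insert eq_insert // eqb_id /Phi mem_insert // setD1_insert //.
rewrite eq_insert // eqbF_neg.
by case: (smoothed k') (smoothed k) (resolved k') (B'.1 == _) (B'.2.1 == _)
  => [] [] [] [] [].
Qed.

(** The vertex [b] alone contributes [kink_diff]. The contributions of the other
vertices are those between the bases, provided that the positions agree. *)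
Lemma cone_diff_split k k' B B' : is_base B -> is_base B' ->
  cone_diff (place k B) (place k' B')
    = kink_diff k k' B B' + (if k == k' then cone_diff B B' else 0).
Proof.
move=> HB HB'; case/and3P: (HB) => _ bS bs; case/and3P: (HB') => _ bS' bs'.
have ER c : c != b -> ((place k' B').1 == c |: (place k B).1)
    = (resolved k' == resolved k) && (B'.1 == c |: B.1).
  by move=> cb; rewrite insert_setU1 eq_insert // in_setU1 negb_or eq_sym cb.
have Erest : \sum_(c | (c != b) && (c \in double_points D :\: (place k B).1))
     (if (place k' B').1 == c |: (place k B).1
      then Phi (resolution (place k B).1) c (place k B).2 (place k' B').2
      else 0)
   = if k == k' then
       \sum_(c | (c != b) && (c \in double_points D :\: B.1))
         (if B'.1 == c |: B.1 then Phi (resolution B.1) c B.2 B'.2 else 0)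
     else 0.
  have -> (x : 'F_2) : (if k == k' then x else 0) = x *+ (k == k').
    by case: (k == k').
  rewrite -sumrMnl; apply: eq_big => c.
    by case: eqP => //= /eqP cb; rewrite !in_setD in_insert.
  case/andP=> cb _; rewrite ER //; have [Er|Er] /= := eqVneq.
    case: (B'.1 == _); last by rewrite mul0rn.
    by rewrite Phi_place //; case: (k == k').
  have -> : (k == k') = false by apply: contraNF Er => /eqP ->.
  by rewrite mulr0n.
rewrite (cone_diff_at_b (place k B)) (cone_diff_at_b B).
rewrite [X in _ + (_ + X) = _]Erest.
rewrite (setU1_neq _ bS') if_same add0r Phi_kink //.
rewrite [(place k' B').1 == (place k B).1]eq_insert //.
rewrite in_setD mem_insert // double_b andbT /kink_diff.
have [Er|Er] /= := eqVneq (resolved k') (resolved k); last first.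
  have -> : (k == k') = false by apply: contraNF Er => /eqP ->.
  rewrite !addr0 add0r.
  by case: (resolved k); rewrite //= if_same.
set g := (X in if ~~ resolved k then X else 0).
have -> : (if ~~ resolved k then g else 0) = 0.
  case: ifP => // rk; rewrite /g Er (negPf rk) /=.
  by rewrite if_same.
rewrite add0r; have [E1|E1] := eqVneq B'.1 B.1; last first.
  rewrite add0r /=.
  by case: (k == k'); rewrite ?add0r.
rewrite (diff_place HB HB' E1 Er) -addrA /=; congr (_ + _).
  rewrite Er; case: (B'.2.1 == _); rewrite ?andbT ?andbF //=.
  by case: ifP => //; case: (resolved k).
by case: (k == k'); rewrite ?addr0.
Qed.

(** The three maps of the sequence at [b], in terms of positions: Delta, then
Delta mu, then mu. *)
Lemma kink_diffE k k' B B' : is_base B -> is_base B' ->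
  kink_diff k k' B B'
    = (diff_id k k' && (B == B'))%:R + (diff_x k k' && mul_trunk B B')%:R.
Proof.
move=> HB HB'; case/and3P: (HB) => /andP[_ XO] bS bs.
case/and3P: (HB') => /andP[_ XO'] bS' bs'.
have bO := base_smoothing HB.
rewrite /kink_diff /mul_trunk.
case: B B' HB HB' XO bS bs XO' bS' bs' bO => [S [s X]] [S' [s' X']] /=.
move=> HB HB' XO bS bs XO' bS' bs' bO.
rewrite !xpair_eqE [S' == S]eq_sym [s' == s]eq_sym.
have [ES|_] := eqVneq S S'; last by rewrite !andbF addr0.
have [Es|_] := eqVneq s s'; last by rewrite !andbF addr0.
rewrite /= !smoothing_place //.
move: XO XO' HB HB'; rewrite -ES -Es /state_smoothing /= => XO XO' HB HB'.
set O := oriented_at _ _ in XO XO' *.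
have split e := saddle_split glue_b bO e XO XO'.
have merge e := saddle_merge glue_b bO e XO XO'.
have genus e e' := genus1_kink glue_b bO e e' XO XO'.
case: k k' => [[]|[[] []]] [[]|[[] []]]; rewrite /= ?addr0 ?add0r //.
- exact: (split true).
- exact: (split false).
- exact: (merge true).
- exact: (merge false).
- exact: (genus true true).
- exact: (genus true false).
- exact: (genus false true).
- exact: (genus false false).
Qed.

End Cone.

(** * Degrees *)

Section Degrees.
Variables (D : singular_diagram) (b : D) (r : bool).
Hypothesis double_b : b \in double_points D.
Hypothesis glue_b : glue D (b, r) = (b, r).
Implicit Types (k : position) (t B : cone_state D).

(** The bidegree of [place k B] relative to that of [B]. In the cone, a positive
resolution of [b] raises the homological degree by 2: it lowers both the number
of double points resolved negatively and the number of negative crossings. *)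
Definition homological_degree k : int := (smoothed k + 2 * resolved k)%N%:Z.

Definition quantum_degree k : int :=
  (smoothed k + 3 * resolved k)%N%:Z
  + (if k is inr (_, e) then if e then -1 else 1 else 0).

Lemma label_degreeE (G : shadow) (W X : {set {set point G}}) : X \subset W ->
  label_degree W X = #|W|%:Z - 2 * #|X|%:Z.
Proof.
move=> XW; rewrite /label_degree (setIidPr XW).
have := cardsID X W; rewrite (setIidPr XW); lia.
Qed.

Lemma card_with_loop (O : {set D}) e (X : {set {set point D}}) : b \notin O ->
  X \subset circles O -> #|with_loop b r e X| = (e + #|X|)%N.
Proof.
move=> bO XO.
have XF : X \subset followers b r.
  exact: subset_trans XO (circles_followers glue_b bO).
have cX : #|with_loop b r false X| = #|X|.
  by apply: card_in_imset => c c' /(subsetP XF) ? /(subsetP XF); apply: cut_inj.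
case: e => //=; rewrite cardsU1 -[cut b r @: X]/(with_loop b r false X) cX.
by rewrite loop_in_with_loop.
Qed.

(** A positive resolution of [b] raises the quantum degree by 3, through
[n_+ - 2 n_-], and a loop labelled by 1 or x contributes 1 or -1. *)
Lemma in_cone_place i j k B : is_base b B ->
  in_cone i j (place b r k B)
    = in_cone (i - homological_degree k) (j - quantum_degree k) B.
Proof.
move=> HB; case/and3P: (HB) => /andP[Sd XO] bS bs.
have bO := base_smoothing double_b HB.
have kb : kind b = Double by move: double_b; rewrite inE; case: (kind b).
have Sd' : insert b (resolved k) B.1 \subset double_points D.
  by case: (resolved k) => //=; rewrite subUset sub1set double_b.
have P' : #|resolution (insert b (resolved k) B.1)|
    = (resolved k + #|resolution B.1|)%N.
  have -> : resolution (insert b (resolved k) B.1)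
      = insert b (resolved k) (resolution B.1).
    apply/setP=> v; have [->|vb] := eqVneq v b.
      by rewrite inE kb !mem_insert // inE kb.
    by rewrite in_insert // !inE in_insert.
  by rewrite card_insert // inE kb.
have s' : #|insert b (smoothed k) B.2.1| = (smoothed k + #|B.2.1|)%N.
  exact: card_insert.
have S' : #|insert b (resolved k) B.1| = (resolved k + #|B.1|)%N.
  exact: card_insert.
rewrite /in_cone /in_C /in_Cbar /= Sd Sd' /=.
rewrite -[oriented_at _ B.2.1]/(state_smoothing B) XO.
rewrite -[oriented_at _ _]/(state_smoothing (place b r k B)) smoothing_place //.
have XO' : labelling b r k B.2.2
    \subset circles (insert b (oriented k) (state_smoothing B)).
  case: k {Sd' P' s' S'} => [p|[p e]] //=; rewrite (circles_setU1 glue_b) //.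
  by case: e; rewrite /= ?setUS ?imsetS // subsetU // imsetS ?orbT.
have L : label_degree (circles (insert b (oriented k) (state_smoothing B)))
      (labelling b r k B.2.2)
    = label_degree (circles (state_smoothing B)) B.2.2
      + (if k is inr (_, e) then if e then -1 else 1 else 0).
  rewrite !label_degreeE //; case: k {Sd' P' s' S' XO'} => [p|[p e]] /=.
    by rewrite addr0.
  rewrite (circles_setU1 glue_b) // -[loop b r |: _]/(with_loop b r true _).
  rewrite !(card_with_loop _ bO) //; move: #|_| #|_| => m n.
  by case: e; rewrite /=; lia.
rewrite XO' L s' /=.
rewrite /n_plus /n_minus P'.
have C1 := cardsC (resolution (insert b (resolved k) B.1)).
have C2 := cardsC (resolution B.1).
have D1 := cardsID B.1 (double_points D).
have D2 := cardsID (insert b (resolved k) B.1) (double_points D).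
rewrite (setIidPr _) // in D1; rewrite (setIidPr _) // in D2.
rewrite P' in C1; rewrite S' in D2.
rewrite /homological_degree /quantum_degree.
move: (if k is inr (_, e) then if e then -1 else 1 else 0 : int) => q.
move: (label_degree _ _) (nat_of_bool _) (nat_of_bool _) C1 C2 D1 D2 => l sm re.
move: #|_| #|_| #|_| #|_| #|_| #|_| #|_| #|_| #|_|.
clear -i j q l sm re => *.
by congr (_ && _); apply/eqP/eqP; lia.
Qed.

End Degrees.

(** * The contracting homotopy *)

Section Homotopy.
Variables (D : singular_diagram) (b : D) (r : bool).
Hypothesis double_b : b \in double_points D.
Hypothesis glue_b : glue D (b, r) = (b, r).
Implicit Types (k : position) (x y u w B : cone_state D).

(** The transpose of [diff_id]. On labels it applies eps to the loop when it
starts from an oriented smoothing, and labels the loop by 1 when it arrives at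
one. *)
Definition homotopy x y : bool :=
  [exists k, exists k', exists B, [&& is_base b B, diff_id k' k,
     x == place b r k B & y == place b r k' B]].

Lemma homotopy_from k B u : is_base b B ->
  homotopy (place b r k B) u = (u \in [set place b r k' B | k' in diff_id^~ k]).
Proof.
move=> HB; apply/existsP/imsetP => [[k1 /existsP[k' /existsP[B1]]]|[k' kk' ->]].
  case/and4P=> HB1 kk'; rewrite (eq_place double_b glue_b) //.
  move=> /andP[/eqP -> /eqP ->] /eqP ->.
  by exists k'.
exists k; apply/existsP; exists k'; apply/existsP; exists B.
by rewrite HB !eqxx !andbT.
Qed.

Lemma homotopy_to k B w : is_base b B ->
  homotopy w (place b r k B) = (w \in [set place b r k' B | k' in diff_id k]).
Proof.
move=> HB; apply/existsP/imsetP => [[k' /existsP[k1 /existsP[B1]]]|[k' kk' ->]].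
  case/and4P=> HB1 kk' /eqP ->; rewrite (eq_place double_b glue_b) //.
  move=> /andP[/eqP -> /eqP ->].
  by exists k'.
exists k'; apply/existsP; exists k; apply/existsP; exists B.
by rewrite HB !eqxx !andbT.
Qed.

Lemma sum_image B (Q : pred position) (F : cone_state D -> 'F_2) :
  is_base b B ->
  \sum_(u in [set place b r k B | k in Q]) F u
    = \sum_(k | Q k) F (place b r k B).
Proof.
move=> HB; rewrite big_imset // => k k' _ _ /eqP.
by rewrite (eq_place double_b glue_b) // => /andP[/eqP].
Qed.

Lemma sum_position (Q : pred position) (F : position -> 'F_2) :
  \sum_(k | Q k) F k =
    (if Q (inl true) then F (inl true) else 0)
    + (if Q (inl false) then F (inl false) else 0)
    + ((if Q (inr (true, true)) then F (inr (true, true)) else 0)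
    + (if Q (inr (true, false)) then F (inr (true, false)) else 0)
    + ((if Q (inr (false, true)) then F (inr (false, true)) else 0)
    + (if Q (inr (false, false)) then F (inr (false, false)) else 0))).
Proof.
rewrite big_mkcond big_sumType /= big_bool; congr (_ + _).
transitivity (\sum_(p : bool) \sum_(e : bool)
    if Q (inr (p, e)) then F (inr (p, e)) else 0).
  by rewrite pair_bigA; apply: eq_bigr => -[p e].
by rewrite !big_bool.
Qed.

Lemma F2_addrr (a : 'F_2) : a + a = 0.
Proof. by apply: addrr_pchar2; apply: pchar_Fp. Qed.

(** With [alpha], [beta] the matrices of [diff_id], [diff_x] and [eta] the
transpose of [alpha], the claim is [alpha eta + eta alpha = 1] and
[beta eta + eta beta = 0], since the differential of the base occurs twice. *)
Lemma homotopy_contraction x y : is_state x -> is_state y ->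
  \sum_u (homotopy x u)%:R * cone_diff u y
    + \sum_w cone_diff x w * (homotopy w y)%:R = (x == y)%:R.
Proof.
move=> /(state_place double_b glue_b)[k [B [HB ->]]].
move=> /(state_place double_b glue_b)[k' [B' [HB' ->]]].
rewrite (eq_place double_b glue_b) //.
have -> : \sum_u (homotopy (place b r k B) u)%:R * cone_diff u (place b r k' B')
    = \sum_(k1 | diff_id k1 k) cone_diff (place b r k1 B) (place b r k' B').
  rewrite -(sum_image _ (fun u => cone_diff u _) HB) [RHS]big_mkcond.
  by apply: eq_bigr => u _; rewrite homotopy_from // mulr_natl mulrb.
have -> : \sum_w cone_diff (place b r k B) w * (homotopy w (place b r k' B'))%:R
    = \sum_(k1 | diff_id k' k1) cone_diff (place b r k B) (place b r k1 B').
  rewrite -(sum_image _ (fun w => cone_diff _ w) HB') [RHS]big_mkcond.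
  by apply: eq_bigr => w _; rewrite homotopy_to // mulr_natr mulrb.
have M k1 k2 : cone_diff (place b r k1 B) (place b r k2 B')
    = (diff_id k1 k2 && (B == B'))%:R + (diff_x k1 k2 && mul_trunk b r B B')%:R
      + (if k1 == k2 then cone_diff B B' else 0).
  by rewrite (cone_diff_split double_b glue_b) // (kink_diffE double_b glue_b).
rewrite [X in X + _](eq_bigr _ (fun k1 _ => M k1 k')).
rewrite [X in _ + X](eq_bigr _ (fun k1 _ => M k k1)).
rewrite !sum_position.
move: (B == B') (mul_trunk _ _ _ _) (cone_diff B B') => e m c.
have cc := F2_addrr c.
case: k k' => [[]|[[] []]] [[]|[[] []]]; rewrite /= ?addr0 ?add0r //.
all: case: e; case: m; rewrite /= ?addr0 ?add0r ?cc ?F2_addrr //.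
Qed.

Lemma diff_id_degree k k' : diff_id k k' ->
  homological_degree k' = homological_degree k + 1 /\
  quantum_degree k' = quantum_degree k.
Proof. by case: k k' => [[]|[[] []]] [[]|[[] []]]. Qed.

Lemma homotopy_degree i j x y : homotopy x y ->
  in_cone i j x = in_cone (i - 1) j y.
Proof.
case/existsP=> k /existsP[k' /existsP[B /and4P[HB kk' /eqP -> /eqP ->]]].
rewrite !(in_cone_place double_b glue_b) //.
by have [-> ->] := diff_id_degree kk'; rewrite [_ + 1]addrC opprD addrA.
Qed.

Lemma in_cone_state i j x : in_cone i j x -> is_state x.
Proof. by case/andP=> xd /and3P[xc _ _]; rewrite /is_state xd. Qed.

End Homotopy.

Theorem theorem3 (D : singular_diagram) (b : D) :
  b \in double_points D -> is_kink b ->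
  forall (i j : int) (h : Kh D i j), h = 0.
Proof.
move=> double_b [r glue_b] i j; apply: homology_eq0 => v dv.
exists [ffun u : {t : cone_state D | in_cone (i - 1) j t} =>
          \sum_x (homotopy b r (val x) (val u))%:R * v x].
rewrite lfunE; apply/ffunP=> y; rewrite ffunE.
under eq_bigr => u _ do rewrite ffunE.
have H01 (e : bool) : (e%:R : 'F_2) != 0 -> e by case: e; rewrite ?eqxx.
apply/esym.
apply: (@exact_of_contraction _ _ (in_cone (i - 1) j) (in_cone i j)
  (in_cone (i + 1) j) (@cone_diff D) (fun x y => (homotopy b r x y)%:R)).
- by move=> x u xC /H01 /(homotopy_degree double_b glue_b) <-.
- move=> w y' yC /H01 /(homotopy_degree double_b glue_b) ->.
  by rewrite addrK.
- move=> x y' /in_cone_state xs /in_cone_state ys.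
  exact: homotopy_contraction.
- move=> w; move/ffunP: dv => /(_ w).
  by rewrite lfunE !ffunE.
Qed.
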